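(* Consider the distributed matrix multiplication problem of computing $C=A^{\intercal}B$, with $A\in\mathbb{F}^{s\times r}$ and $B\in\mathbb{F}^{s\times t}$, using $N$ workers, with parameters $p,m,n$. Let $K_{\textup{entangled-poly}}\triangleq pmn+p-1$ if $N\ge pmn+p-1$, and $K_{\textup{entangled-poly}}\triangleq N$ if $N<pmn+p-1$. If $m=1$ or $n=1$, then $$K^*_{\textup{linear}}=K_{\textup{entangled-poly}}.$$ Moreover, if in addition the field $\mathbb F$ is finite, then $$\tfrac12 K_{\textup{entangled-poly}}<K^*\le K_{\textup{entangled-poly}}.$$
   Context: Setting. $p,m,n,N,s,r,t$ are positive integers with $p\mid s$, $m\mid r$, $n\mid t$, and $\mathbb{F}$ is a (finite or infinite) field that is sufficiently large, i.e. $|\mathbb F|\ge q_0$ for some threshold $q_0$ depending only on $p,m,n,N$. There are $N$ workers, indexed $0,\dots,N-1$. A computation strategy consists of (arbitrary, possibly non-linear) encoding functions $\boldsymbol f=(f_0,\dots,f_{N-1})$, $f_i:\mathbb F^{s\times r}\to\mathbb F^{\frac sp\times\frac rm}$, and $\boldsymbol g=(g_0,\dots,g_{N-1})$, $g_i:\mathbb F^{s\times t}\to\mathbb F^{\frac sp\times\frac tn}$, together with decoding functions $\boldsymbol d=\{d_{\mathcal K}\}_{\mathcal K\subseteq\{0,\dots,N-1\}}$. Worker $i$ stores $\tilde A_i=f_i(A)$ and $\tilde B_i=g_i(B)$ and returns $\tilde C_i=\tilde A_i^{\intercal}\tilde B_i$; from the results of a subset $\mathcal K$ of workers the master computes the estimate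 $\hat C=d_{\mathcal K}(\{\tilde C_i\}_{i\in\mathcal K})$. The strategy is $k$-recoverable if for every subset $\mathcal K$ of exactly $k$ workers, $\hat C=A^{\intercal}B$ for all inputs $A,B$. The recovery threshold $K(\boldsymbol f,\boldsymbol g,\boldsymbol d)$ is the minimum integer $k$ such that the strategy is $k$-recoverable. Linear code. Partition $A$ into $p\times m$ equal-size blocks $A_{j,k}\in\mathbb F^{\frac sp\times\frac rm}$ and $B$ into $p\times n$ equal-size blocks $B_{j,k}\in\mathbb F^{\frac sp\times\frac tn}$. A computation strategy is a linear code if there are scalars $a_{ijk},b_{ijk}\in\mathbb F$ with $\tilde A_i=\sum_{j,k}A_{j,k}a_{ijk}$ and $\tilde B_i=\sum_{j,k}B_{j,k}b_{ijk}$ for each worker $i$, and for each $\mathcal K$ there are scalars $c_{ijk}\in\mathbb F$ (which may depend on $\mathcal K$) such that the decoded estimate of the block $C_{j,k}=\sum_{\ell}A_{\ell,j}^{\intercal}B_{\ell,k}$ is $\hat C_{j,k}=\sum_{i\in\mathcal K}\tilde C_i c_{ijk}$. $K^*_{\textup{linear}}$ is the minimum of $K(\boldsymbol f,\boldsymbol g,\boldsymbol d)$ over all linear codes; $K^*$ is the minimum of $K(\boldsymbol f,\boldsymbol g,\boldsymbol d)$ over all computation strategies. Standing assumption: $N$ is large enough that at least one $N$-recoverable strategy exists (a linear code when $K^*_{\textup{linear}}$ is concerned, an arbitrary strategy when $K^*$ is concerned). *)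

(* Defs.v *)
From mathcomp Require Import all_boot all_order all_algebra.

Set Implicit Arguments.
Unset Strict Implicit.
Unset Printing Implicit Defensive.

Import GRing.Theory.
Local Open Scope ring_scope.

Fact block_ord_subproof (a d : nat) (j : 'I_d) (x : 'I_(a %/ d)) :
  (j * (a %/ d) + x < a)%N.
Proof.
apply: leq_trans (leq_divM a d).
rewrite mulnC [leqRHS]mulnC; apply: (@leq_trans (j.+1 * (a %/ d))%N).
  by rewrite mulSn addnC mulnC ltn_add2r.
by rewrite leq_mul2r ltn_ord orbT.
Qed.

Definition block_ord (a d : nat) (j : 'I_d) (x : 'I_(a %/ d)) : 'I_a :=
  Ordinal (block_ord_subproof j x).

(* When d %| a and e %| b, these are the d * e blocks of the partition of A
   into blocks of equal size; divisibility is not needed to define them. *)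
Definition block (F : fieldType) (a b : nat) (A : 'M[F]_(a, b)) (d e : nat)
    (j : 'I_d) (k : 'I_e) : 'M[F]_(a %/ d, b %/ e) :=
  mxsub (block_ord j) (block_ord k) A.

(* The type of the decoding functions lets dec K see only the results of the
   workers in K. *)
Record strategy (F : fieldType) (N p m n s r t : nat) := Strategy {
  encA : 'I_N -> 'M[F]_(s, r) -> 'M[F]_(s %/ p, r %/ m);
  encB : 'I_N -> 'M[F]_(s, t) -> 'M[F]_(s %/ p, t %/ n);
  dec : forall K : {set 'I_N},
    ({i : 'I_N | i \in K} -> 'M[F]_(r %/ m, t %/ n)) -> 'M[F]_(r, t)
}.

Section Strategies.
Context (F : fieldType) (N p m n s r t : nat).
Implicit Types (S : strategy F N p m n s r t).
Implicit Types (A : 'M[F]_(s, r)) (B : 'M[F]_(s, t)).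

Definition worker_result S A B (i : 'I_N) : 'M[F]_(r %/ m, t %/ n) :=
  (encA S i A)^T *m encB S i B.

Definition estimate S (K : {set 'I_N}) A B : 'M[F]_(r, t) :=
  dec S (fun i : {i : 'I_N | i \in K} => worker_result S A B (val i)).

(* Without k <= N every k > N would be vacuously recoverable. *)
Definition recoverable S (k : nat) : Prop :=
  (k <= N)%N /\
  forall K : {set 'I_N}, #|K| = k -> forall A B, estimate S K A B = A^T *m B.

Definition linear_code S : Prop :=
  [/\ exists a : 'I_N -> 'I_p -> 'I_m -> F, forall i A,
        encA S i A = \sum_j \sum_k a i j k *: block A j k,
      exists b : 'I_N -> 'I_p -> 'I_n -> F, forall i B,
        encB S i B = \sum_j \sum_k b i j k *: block B j k
    & forall K : {set 'I_N}, exists c : 'I_N -> 'I_m -> 'I_n -> F,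
        forall A B j k, block (estimate S K A B) j k =
          \sum_(i in K) c i j k *: worker_result S A B i].

End Strategies.

Definition is_minimum (P : nat -> Prop) (k : nat) : Prop :=
  P k /\ forall l, P l -> (k <= l)%N.

Definition recovery_threshold (F : fieldType) (N p m n s r t : nat)
    (S : strategy F N p m n s r t) (k : nat) : Prop :=
  is_minimum (recoverable S) k.

(* Strategies with no recovery threshold do not contribute to the minimum. *)
Definition optimal_threshold (F : fieldType) (N p m n s r t : nat)
    (C : strategy F N p m n s r t -> Prop) (k : nat) : Prop :=
  is_minimum (fun l => exists2 S, C S & recovery_threshold S l) k.

Definition K_linear_star (F : fieldType) (N p m n s r t : nat) : nat -> Prop :=
  optimal_threshold (@linear_code F N p m n s r t).

Definition K_star (F : fieldType) (N p m n s r t : nat) : nat -> Prop :=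
  optimal_threshold (fun _ : strategy F N p m n s r t => True).

Definition K_entangled_poly (p m n N : nat) : nat :=
  if (p * m * n + p - 1 <= N)%N then (p * m * n + p - 1)%N else N.

(* Main.v *)
(* Achievability: with the entangled polynomial code, each entry of worker i's
   result is the value at x_i of a polynomial of degree at most pmn + p - 2
   among whose coefficients are the entries of the blocks of A^T B; these are
   recovered by Lagrange interpolation.
   Converse for linear codes, say with m = 1: decoding from K is an identity
   sum_(i in K) c_i a_i (x) b_i = sum_l e_l (x) e_(l,h).  If k < N, use k + 1
   workers of which any one may be omitted.  Their b_i span F^(pn), so pn of
   them form a basis; if at most p - 1 workers remained, some w <> 0 would be
   orthogonal to their a_i, and w (x) e_h would be a combination of the basis
   in which any prescribed coefficient can be made to vanish, hence 0.
   Over a finite field, letting A vary shows that the encodings of B held by k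
   workers determine B, so k >= pn by counting; likewise k >= pm.  When m = 1
   or n = 1 this is k >= pmn, and 2pmn > pmn + p - 1. *)

Require Import Defs.
From mathcomp Require Import all_boot all_order all_algebra.
From mathcomp Require Import boolp classical_sets functions cardinality zify.

Set Implicit Arguments.
Unset Strict Implicit.
Unset Printing Implicit Defensive.

Import Order.TTheory GRing.Theory Num.Theory.

(** * Partition of matrices into blocks *)

Lemma divn_dvd_gt0 (d e : nat) : 0 < e -> d %| e -> 0 < e %/ d.
Proof. by move=> e0 de; rewrite (divn_gt0 _ (dvdn_gt0 e0 de)) dvdn_leq. Qed.

Section Blocks.
Local Open Scope ring_scope.

Lemma block_ord_inj (a d : nat) (j j' : 'I_d) (x x' : 'I_(a %/ d)) :
  (block_ord j x == block_ord j' x') = (j == j') && (x == x').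
Proof.
apply/eqP/andP=> [/(congr1 val) /= e | [/eqP-> /eqP->]] //.
have q0 : (0 < a %/ d)%N by apply: leq_ltn_trans (ltn_ord x).
split; apply/eqP/val_inj => /=.
  have := congr1 (divn^~ (a %/ d)%N) e; rewrite !divnMDl //.
  by rewrite !divn_small ?ltn_ord // !addn0.
have := congr1 (modn^~ (a %/ d)%N) e; rewrite !modnMDl.
by rewrite !modn_small ?ltn_ord.
Qed.

Lemma block_ord_bij (a d : nat) : (d %| a)%N ->
  bijective (fun q : 'I_d * 'I_(a %/ d) => block_ord q.1 q.2).
Proof.
move=> dvd; apply: inj_card_bij => [[j x] [j' x'] /eqP /=|].
  by rewrite block_ord_inj => /andP[/eqP-> /eqP->].
by rewrite card_prod !card_ord mulnC divnK.
Qed.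

Lemma big_block_ord (V : nmodType) (a d : nat) (f : 'I_a -> V) : (d %| a)%N ->
  \sum_x f x = \sum_(j < d) \sum_(y < a %/ d) f (block_ord j y).
Proof.
move=> /block_ord_bij bij.
by rewrite pair_bigA /= (reindex _ (onW_bij _ bij)).
Qed.

Variable F : fieldType.

Lemma block_inj (a b d e : nat) (A B : 'M[F]_(a, b)) :
  (d %| a)%N -> (e %| b)%N ->
  (forall (j : 'I_d) (k : 'I_e), block A j k = block B j k) -> A = B.
Proof.
move=> /block_ord_bij[g _ gK] /block_ord_bij[h _ hK] eqAB.
apply/matrixP=> x y; rewrite -(gK x) -(hK y).
by have /matrixP/(_ (g x).2 (h y).2) := eqAB (g x).1 (h y).1; rewrite !mxE.
Qed.

Lemma block_mul_trmx (a b c d e f : nat) (A : 'M[F]_(a, b)) (B : 'M[F]_(a, c))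
    (j : 'I_e) (k : 'I_f) : (d %| a)%N ->
  block (A^T *m B) j k = \sum_(l < d) (block A l j)^T *m block B l k.
Proof.
move=> dvd; apply/matrixP=> x y; rewrite !mxE summxE (big_block_ord _ dvd).
by apply: eq_bigr => l _; rewrite !mxE; apply: eq_bigr => u _; rewrite !mxE.
Qed.

Lemma block_delta (a b d e : nat) (j j' : 'I_d) (k k' : 'I_e)
    (x : 'I_(a %/ d)) (y : 'I_(b %/ e)) :
  block (delta_mx (block_ord j x) (block_ord k y) : 'M[F]_(a, b)) j' k' =
  ((j' == j) && (k' == k))%:R *: delta_mx x y.
Proof.
apply/matrixP=> u v; rewrite !mxE !block_ord_inj -natrM mulnb.
by rewrite andbACA.
Qed.

(** Glues blocks together: [pick] locates an entry in its block; the default 0 concerns entries that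
    lie in no block. *)
Definition unblock (a b d e : nat)
    (E : 'I_d -> 'I_e -> 'M[F]_(a %/ d, b %/ e)) : 'M[F]_(a, b) :=
  \matrix_(x, y)
    if [pick q : ('I_d * 'I_(a %/ d)) * ('I_e * 'I_(b %/ e)) |
         (block_ord q.1.1 q.1.2 == x) && (block_ord q.2.1 q.2.2 == y)]
    is Some q then E q.1.1 q.2.1 q.1.2 q.2.2 else 0.

Lemma unblockK (a b d e : nat) (E : 'I_d -> 'I_e -> 'M[F]_(a %/ d, b %/ e))
  (j : 'I_d) (k : 'I_e) : block (unblock E) j k = E j k.
Proof.
apply/matrixP=> x y; rewrite !mxE; case: pickP => [[[j' x'] [k' y']] /=|].
  by rewrite !block_ord_inj => /andP[/andP[/eqP-> /eqP->] /andP[/eqP-> /eqP->]].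
by move=> /(_ ((j, x), (k, y))); rewrite /= !eqxx.
Qed.

End Blocks.

(** * Rank argument for the linear converse *)

Section RankConverse.
Local Open Scope ring_scope.
Variable F : fieldType.

Lemma small_set_orthogonal (p : nat) (I : finType) (a : I -> 'I_p -> F)
    (D : {set I}) : (#|D| < p)%N ->
  exists2 w : 'cV[F]_p, w != 0 & forall i, i \in D -> \sum_l a i l * w l 0 = 0.
Proof.
move=> ltDp; pose M : 'M[F]_(#|D|, p) := \matrix_(i, l) a (enum_val i) l.
have : kermx M^T != 0.
  rewrite kermx_eq0 /row_free mxrank_tr; apply: contraL ltDp => /eqP <-.
  by rewrite -leqNgt rank_leq_row.
case/rowV0Pn=> v /sub_kermxP vM v0; exists v^T => [|i iD].
  by apply: contra_neq v0 => /(congr1 trmx); rewrite trmxK trmx0.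
have /matrixP/(_ 0 (enum_rank_in iD i)) := vM; rewrite !mxE => vMi.
rewrite -[RHS]vMi; apply: eq_bigr => l _.
by rewrite !mxE enum_rankK_in // mulrC.
Qed.

(** The coordinates of w (x) e_h in a basis do not depend on the decoding coefficients [c], whereas
    omitting a basis worker makes its coordinate zero. *)
Lemma rank_converse (p n k : nat) (a : 'I_k -> 'I_p -> F)
    (b : 'I_k -> 'I_p -> 'I_n -> F) :
  (0 < n)%N -> (0 < k)%N ->
  (forall (i0 : 'I_k) (h : 'I_n), exists2 c : 'I_k -> F, c i0 = 0 &
     forall l l' h', \sum_i c i * a i l * b i l' h' =
       ((l == l') && (h' == h))%:R) ->
  (p * n + p <= k)%N.
Proof.
move=> n0 k0 H.
pose B : 'M[F]_(k, p * n) := \matrix_i mxvec (\matrix_(l, h) b i l h).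
have BE i l h : B i (mxvec_index l h) = b i l h.
  by rewrite mxE mxvecE mxE.
(* At [l' = l] and varying row index, the identity writes each unit vector as a combination of rows
   of [B] with coefficients [c i * a i l]. *)
have fullB : row_full B.
  rewrite -sub1mx; apply/row_subP=> q; case/mxvec_indexP: q => l h.
  have [c _ Hc] := H (Ordinal k0) h.
  apply/submxP; exists (\row_i (c i * a i l)).
  rewrite row1 -mxvec_delta; apply/rowP=> q; case/mxvec_indexP: q => l' h'.
  rewrite mxvecE mxE [RHS]mxE eq_sym -Hc; apply: eq_bigr => i _.
  by rewrite BE mxE.
pose f := fullrankfun fullB.
have f_inj : injective f by apply: fullrankfun_inj.
rewrite leqNgt; apply/negP => ltk.
(* [D] holds the workers outside the basis of rows selected by [f]. *)
pose D := ~: [set f u | u : 'I_(p * n)].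
have cD : (#|D| < p)%N.
  have := cardsC [set f u | u : 'I_(p * n)].
  rewrite card_imset // !card_ord -/D => e; rewrite -e in ltk.
  by rewrite ltn_add2l in ltk.
have [w w0 wD] := small_set_orthogonal a cD.
pose al i := \sum_l a i l * w l 0.
pose h := Ordinal n0.
pose v : 'rV[F]_(p * n) := mxvec (\matrix_(l, h') (w l 0 *+ (h' == h))).
pose y := v *m invmx (rowsub f B).
(* Pairing the identity with [w] kills the workers in [D], so every admissible [c] yields the same
   coordinates [y] of [v] in the basis. *)
have key (c : 'I_k -> F) :
    (forall l l' h', \sum_i c i * a i l * b i l' h' =
       ((l == l') && (h' == h))%:R) ->
    y = \row_u (c (f u) * al (f u)).
  move=> Hc; rewrite /y; apply: (canLR (mulmxK (fullrowsub_unit fullB))).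
  apply/rowP=> q; case/mxvec_indexP: q => l' h'.
  rewrite mxvecE !mxE.
  transitivity (\sum_i c i * al i * b i l' h').
    transitivity (\sum_l w l 0 * \sum_i c i * a i l * b i l' h').
      rewrite (bigD1 l') //= [X in _ + X]big1 ?addr0 => [|l ll'].
        by rewrite Hc eqxx /= mulr_natr.
      by rewrite Hc (negbTE ll') mulr0.
    under eq_bigr do rewrite mulr_sumr.
    rewrite exchange_big; apply: eq_bigr => i _.
    rewrite /al mulr_sumr mulr_suml; apply: eq_bigr => l _.
    by rewrite mulrC -!mulrA; congr (_ * (_ * _)); rewrite mulrC.
  rewrite (bigID (mem D)) /= big1 ?add0r => [|i iD]; last first.
    by rewrite /al wD // mulr0 mul0r.
  under eq_bigl => i do rewrite inE negbK.
  rewrite big_imset /=; last by move=> ? ? _ _; apply: f_inj.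
  by apply: eq_bigr => u _; rewrite !mxE mxvecE mxE.
(* For coordinate [u], take the decoding that omits worker [f u]. *)
have y0 : y = 0.
  apply/rowP=> u; have [c cu Hc] := H (f u) h.
  by rewrite (key c Hc) !mxE cu mul0r.
have v0 : v = 0.
  by rewrite -[v](mulmxKV (fullrowsub_unit fullB)) -/y y0 mul0mx.
case/negP: w0; apply/eqP/colP=> l.
have /rowP/(_ (mxvec_index l h)) := v0.
by rewrite mxvecE !mxE eqxx.
Qed.

End RankConverse.

(** * Converse for linear codes *)

Lemma mul_scaled_delta (F : fieldType) (a b c : nat) (x y : F)
    (u : 'I_a) (v : 'I_b) (w : 'I_c) :
  ((x *: delta_mx u v)^T *m (y *: delta_mx u w) =
   (x * y) *: delta_mx v w :> 'M[F]_(b, c))%R.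
Proof.
rewrite -scalemxAr linearZ /= -scalemxAl trmx_delta mul_delta_mx !scalerA.
by rewrite mulrC.
Qed.

Section LinearConverse.
Local Open Scope ring_scope.
Variables (F : fieldType) (N p m n s r t : nat).
Hypotheses (s0 : (0 < s)%N) (r0 : (0 < r)%N) (t0 : (0 < t)%N).
Hypotheses (ps : (p %| s)%N) (mr : (m %| r)%N) (nt : (n %| t)%N).
Variable S : strategy F N p m n s r t.

(** Both sides of the decoding rule are bilinear in the blocks, so matrix units as inputs extract
    the scalar identities. *)
Lemma linear_code_tensor (k : nat) : linear_code S -> recoverable S k ->
  exists a b, forall K : {set 'I_N}, #|K| = k ->
    exists c : 'I_N -> 'I_m -> 'I_n -> F, forall j h (l l' : 'I_p) j' h',
      \sum_(i in K) c i j h * a i l j' * b i l' h' =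
        [&& l == l', j' == j & h' == h]%:R.
Proof.
case=> [[a Ha] [b Hb] Hc] [_ rec]; exists a, b => K cK.
have [c {}Hc] := Hc K; exists c => j h l l' j' h'.
pose u := Ordinal (divn_dvd_gt0 s0 ps).
pose x := Ordinal (divn_dvd_gt0 r0 mr); pose y := Ordinal (divn_dvd_gt0 t0 nt).
(* The row position [u] is common to [A] and [B]: worker results are multiples of [delta_mx x y]
   even when [l] and [l'] differ. *)
pose A : 'M[F]_(s, r) := delta_mx (block_ord l u) (block_ord j' x).
pose B : 'M[F]_(s, t) := delta_mx (block_ord l' u) (block_ord h' y).
have encAE i : encA S i A = a i l j' *: delta_mx u x.
  rewrite Ha (bigD1 l) //= [X in _ + X]big1 => [|l1 ll1]; last first.
    by rewrite big1 // => j1 _; rewrite block_delta (negbTE ll1) scale0r scaler0.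
  rewrite (bigD1 j') //= [X in _ + X + _]big1 => [|j1 jj1]; last first.
    by rewrite block_delta (negbTE jj1) andbF scale0r scaler0.
  by rewrite block_delta !eqxx scale1r !addr0.
have encBE i : encB S i B = b i l' h' *: delta_mx u y.
  rewrite Hb (bigD1 l') //= [X in _ + X]big1 => [|l1 ll1]; last first.
    by rewrite big1 // => j1 _; rewrite block_delta (negbTE ll1) scale0r scaler0.
  rewrite (bigD1 h') //= [X in _ + X + _]big1 => [|j1 jj1]; last first.
    by rewrite block_delta (negbTE jj1) andbF scale0r scaler0.
  by rewrite block_delta !eqxx scale1r !addr0.
have := Hc A B j h; rewrite rec // (@block_mul_trmx _ _ _ _ p) //.
move/matrixP/(_ x y); rewrite !summxE => E.
transitivity (\sum_(i in K) (c i j h *: worker_result S A B i) x y).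
  apply: eq_bigr => i _; rewrite /worker_result encAE encBE.
  by rewrite mul_scaled_delta !mxE !eqxx /= mulr1 !mulrA.
rewrite -E (bigD1 l) //= [X in _ + X]big1 => [|l1 ll1]; last first.
  by rewrite block_delta (negbTE ll1) scale0r trmx0 mul0mx mxE.
rewrite !block_delta eqxx /= mul_scaled_delta !mxE !eqxx mulr1 addr0.
by rewrite -natrM mulnb (eq_sym j') (eq_sym h') andbCA.
Qed.

Lemma linear_converse (k : nat) : (0 < p)%N -> (0 < m)%N -> (0 < n)%N ->
  m = 1%N \/ n = 1%N ->
  linear_code S -> recoverable S k -> (K_entangled_poly p m n N <= k)%N.
Proof.
move=> p0 m0 n0 mn1 linS recS.
have [leNk|ltkN] := leqP N k.
  by rewrite (leq_trans _ leNk) // /K_entangled_poly; case: ifP.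
(* Since k + 1 <= N here, this bound also excludes N < pmn + p - 1. *)
suff: (p * (m * n) + p <= k.+1)%N.
  rewrite /K_entangled_poly mulnA; case: ifP => [_ lek|/negbT H1 lek].
    by rewrite leq_subLR add1n.
  by move: H1; rewrite -ltnNge; lia.
have [a [b Hab]] := linear_code_tensor linS recS.
pose emb := widen_ord ltkN.
have emb_inj : injective emb by move=> i i' /(congr1 val) /= /val_inj.
(* Among the first k + 1 workers any [i0] is dispensable: decode from the other k and give [i0]
   coefficient zero. *)
have {Hab} H (i0 : 'I_k.+1) : exists c : 'I_k.+1 -> 'I_m -> 'I_n -> F,
    (forall j h, c i0 j h = 0) /\ forall j h (l l' : 'I_p) j' h',
      \sum_i c i j h * a (emb i) l j' * b (emb i) l' h' =
        [&& l == l', j' == j & h' == h]%:R.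
  have [|c Hc] := Hab (emb @: [set~ i0]).
    by rewrite card_imset // cardsC1 card_ord.
  exists (fun i j h => if i == i0 then 0 else c (emb i) j h).
  split=> [j h|j h l l' j' h']; first by rewrite eqxx.
  rewrite -Hc big_imset /=; last by move=> ? ? _ _; apply: emb_inj.
  rewrite (bigD1 i0) //= eqxx !mul0r add0r; apply: eq_big => [i|i /negbTE->//].
  by rewrite !inE.
case: mn1 => e.
  rewrite e mul1n.
  have j0 : 'I_m by exact: Ordinal m0.
  have m_eq (j : 'I_m) : j = j0.
    by apply: val_inj; case: j j0 => [j Hj] [i Hi] /=; lia.
  apply: (@rank_converse F p n k.+1 (fun i l => a (emb i) l j0)
            (fun i => b (emb i))) => // i0 h.
  have [c [c0 Hc]] := H i0; exists (fun i => c i j0 h) => // l l' h'.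
  by rewrite Hc eqxx.
(* For n = 1 the encodings of A and B exchange roles. *)
rewrite e muln1.
have h0 : 'I_n by exact: Ordinal n0.
apply: (@rank_converse F p m k.+1 (fun i l => b (emb i) l h0)
            (fun i => a (emb i))) => // i0 j.
have [c [c0 Hc]] := H i0; exists (fun i => c i j h0) => // l l' j'.
have := Hc j h0 l' l j' h0; rewrite eqxx andbT eq_sym => <-.
by apply: eq_bigr => i _; rewrite mulrAC.
Qed.

End LinearConverse.

(** * Achievability by the entangled polynomial code *)

Section EntangledPolynomialCode.
Local Open Scope ring_scope.
Variable F : fieldType.

Section Lagrange.
Variables (I : finType) (x : I -> F) (K : {set I}).

Definition lagrange_poly (i : I) : {poly F} :=
  (\prod_(j in K :\ i) (x i - x j))^-1 *:
    \prod_(j in K :\ i) ('X - (x j)%:P).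

Lemma lagrange_polyE : injective x ->
  {in K &, forall i j, (lagrange_poly i).[x j] = (i == j)%:R}.
Proof.
move=> x_inj i j iK jK; rewrite /lagrange_poly hornerZ horner_prod.
under [X in _ * X]eq_bigr do rewrite hornerXsubC.
have [<-|ij] := eqVneq i j.
  rewrite mulVf //; apply/prodf_neq0 => l; rewrite !inE => /andP[li _].
  by rewrite subr_eq0 (inj_eq x_inj) eq_sym.
by rewrite [X in _ * X](bigD1 j) ?inE 1?eq_sym ?ij //= subrr mul0r mulr0.
Qed.

Lemma size_lagrange_poly (i : I) : i \in K ->
  (size (lagrange_poly i) <= #|K|)%N.
Proof.
move=> iK; rewrite (cardsD1 i) iK add1n.
apply: leq_trans (size_scale_leq _ _) _.
by rewrite -big_enum /= size_prod_XsubC -cardE.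
Qed.

(** A nonzero difference of the two sides would have size at most [#|K|] but [#|K|] distinct
    roots. *)
Lemma lagrange_interpolation (P : {poly F}) : injective x ->
  (size P <= #|K|)%N -> P = \sum_(i in K) P.[x i] *: lagrange_poly i.
Proof.
move=> x_inj szP; apply/eqP; rewrite -subr_eq0; apply: contraT => nz.
have := max_poly_roots (rs := map x (enum K)) nz; rewrite size_map -cardE.
rewrite map_inj_uniq // enum_uniq => /(_ _ isT) sz.
have: (#|K| < #|K|)%N; last by rewrite ltnn.
apply: leq_trans (sz _) _.
  apply/allP => _ /mapP[j jK ->]; rewrite mem_enum in jK.
  rewrite /root hornerD hornerN horner_sum (bigD1 j) //= hornerZ.
  rewrite lagrange_polyE // eqxx mulr1 big1 ?addr0 ?subrr // => i /andP[iK ij].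
  by rewrite hornerZ lagrange_polyE // (negbTE ij) mulr0.
apply: leq_trans (size_polyD _ _) _; rewrite geq_max szP size_polyN /=.
apply: leq_trans (size_sum _ _ _) _; apply/bigmax_leqP => i iK.
by apply: leq_trans (size_scale_leq _ _) (size_lagrange_poly iK).
Qed.

End Lagrange.

Variables (N p m n s r t : nat) (x : 'I_N -> F).

(** Exponents in [encB] run backwards in the row block, so that products of equal row blocks share
    the exponent p - 1 + jp + kpm. The decoder reads this coefficient of the interpolating
    polynomial. *)
Definition entangled_code : strategy F N p m n s r t := Strategy
  (fun i A => \sum_(j < p) \sum_(k < m) x i ^+ (j + k * p) *: block A j k)
  (fun i B => \sum_(j < p) \sum_(k < n)
     x i ^+ (p.-1 - j + k * (p * m)) *: block B j k)
  (fun K res => unblock (fun (j : 'I_m) (k : 'I_n) =>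
     \sum_i (lagrange_poly x K (val i))`_(p.-1 + j * p + k * (p * m)) *: res i)).

Lemma entangled_linear : linear_code entangled_code.
Proof.
split; first by exists (fun i (j : 'I_p) (k : 'I_m) => x i ^+ (j + k * p)).
  by exists (fun i (j : 'I_p) (k : 'I_n) => x i ^+ (p.-1 - j + k * (p * m))).
move=> K; exists (fun i (j : 'I_m) (k : 'I_n) =>
  (lagrange_poly x K i)`_(p.-1 + j * p + k * (p * m))) => A B j k.
by rewrite /estimate /= unblockK [RHS]big_sub.
Qed.

(** By uniqueness of mixed-radix digits, no unwanted product lands on the exponent used for
    C_{j,k}. *)
Lemma entangled_exponent (l l' j j' k k' : nat) :
  (l < p)%N -> (l' < p)%N -> (j < m)%N -> (j' < m)%N ->
  (p.-1 + j * p + k * (p * m) ==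
     (l + j' * p) + (p.-1 - l' + k' * (p * m)))%N =
  [&& l == l', j' == j & k' == k].
Proof.
move=> lp l'p jm j'm; apply/eqP/and3P=> [e|[/eqP-> /eqP-> /eqP->]]; last lia.
have p0 : (0 < p)%N by lia.
have m0 : (0 < m)%N by lia.
(* Moving [l'] across removes the truncated subtraction and leaves [l'] and [l] as last digits in
   base p. *)
have e1 : ((j + k * m) * p + l' = (j' + k' * m) * p + l)%N by nia.
have := congr1 (divn^~ p) e1; rewrite !divnMDl // !divn_small // !addn0.
have := congr1 (modn^~ p) e1; rewrite !modnMDl !modn_small // => -> e2.
have := congr1 (divn^~ m) e2; have := congr1 (modn^~ m) e2.
rewrite ![(_ + _ * m)%N]addnC !modnMDl !divnMDl // !modn_small // => ->.
by rewrite !divn_small // !addn0 => ->; rewrite !eqxx.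
Qed.

Lemma entangled_recoverable : injective x -> (0 < p)%N ->
  (p %| s)%N -> (m %| r)%N -> (n %| t)%N ->
  (0 < m)%N -> (0 < n)%N ->
  (p * m * n + p - 1 <= N)%N ->
  recoverable entangled_code (p * m * n + p - 1).
Proof.
move=> x_inj p0 ps mr nt m0 n0 leN; split=> // K cK A B.
apply: (block_inj mr nt) => j k.
rewrite /estimate /= unblockK (@block_mul_trmx _ _ _ _ p) //.
rewrite -(big_sub (mem K) (fun i => (lagrange_poly x K i)`_
   (p.-1 + j * p + k * (p * m)) *: worker_result entangled_code A B i)).
apply/matrixP=> u v.
(* At [x i], [PA w] and [PB w] give the entries (w, u) and (w, v) of the encoded matrices. *)
pose PA w : {poly F} := \sum_(l < p) \sum_(j' < m)
  block A l j' w u *: 'X^(l + j' * p).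
pose PB w : {poly F} := \sum_(l < p) \sum_(k' < n)
  block B l k' w v *: 'X^(p.-1 - l + k' * (p * m)).
pose P := \sum_w PA w * PB w.
have Px i : worker_result entangled_code A B i u v = P.[x i].
  rewrite mxE /P horner_sum; apply: eq_bigr => w _.
  rewrite hornerM mxE /= !summxE /PA /PB !horner_sum; congr (_ * _).
    apply: eq_bigr => l _; rewrite summxE horner_sum; apply: eq_bigr => j' _.
    by rewrite mxE !hornerE mulrC.
  apply: eq_bigr => l _; rewrite summxE horner_sum; apply: eq_bigr => j' _.
  by rewrite mxE !hornerE mulrC.
have PE : P = \sum_w \sum_(l < p) \sum_(j' < m) \sum_(l' < p) \sum_(k' < n)
  (block A l j' w u * block B l' k' w v) *:
    'X^((l + j' * p) + (p.-1 - l' + k' * (p * m))).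
  apply: eq_bigr => w _; rewrite /PA mulr_suml; apply: eq_bigr => l _.
  rewrite mulr_suml; apply: eq_bigr => j' _; rewrite /PB mulr_sumr.
  apply: eq_bigr => l' _; rewrite mulr_sumr; apply: eq_bigr => k' _.
  by rewrite -scalerAl -scalerAr scalerA -exprD.
(* The largest exponent is (p-1) + (m-1)p + (p-1) + (n-1)pm = pmn + p - 2. *)
have szP : (size P <= #|K|)%N.
  rewrite cK PE.
  apply: leq_trans (size_sum _ _ _) _; apply/bigmax_leqP => w _.
  apply: leq_trans (size_sum _ _ _) _; apply/bigmax_leqP => l _.
  apply: leq_trans (size_sum _ _ _) _; apply/bigmax_leqP => j' _.
  apply: leq_trans (size_sum _ _ _) _; apply/bigmax_leqP => l' _.
  apply: leq_trans (size_sum _ _ _) _; apply/bigmax_leqP => k' _.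
  apply: leq_trans (size_scale_leq _ _) _; rewrite size_polyXn.
  have : (j'.+1 * p <= m * p)%N by rewrite leq_mul2r ltn_ord orbT.
  have : (k'.+1 * (p * m) <= n * (p * m))%N by rewrite leq_mul2r ltn_ord orbT.
  have := ltn_ord l; have := ltn_ord l'; lia.
(* The decoding weights are coefficients of Lagrange polynomials, so the decoded entry is a
   coefficient of [P]. *)
transitivity (P`_(p.-1 + j * p + k * (p * m))).
  rewrite [in RHS](lagrange_interpolation x_inj szP) coef_sum summxE.
  by apply: eq_bigr => i _; rewrite mxE Px coefZ mulrC.
rewrite PE coef_sum summxE.
under [RHS]eq_bigr do rewrite mxE.
rewrite exchange_big /=; apply: eq_bigr => w _.
rewrite coef_sum; apply: eq_bigr => l _.
have coefE (j' : 'I_m) (l' : 'I_p) (k' : 'I_n) :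
    ((block A l j' w u * block B l' k' w v) *:
      'X^((l + j' * p) + (p.-1 - l' + k' * (p * m))))`_
        (p.-1 + j * p + k * (p * m)) =
    [&& l == l', j' == j & k' == k]%:R * (block A l j w u * block B l k w v).
  rewrite coefZ coefXn entangled_exponent // !val_eqE mulrC.
  by case: and3P => [[/eqP<- /eqP-> /eqP->]|_]; rewrite ?mul1r ?mul0r.
rewrite coef_sum (bigD1 j) //= [X in _ + X]big1 => [|j' jj'].
  rewrite addr0 coef_sum (bigD1 l) //= [X in _ + X]big1 => [|l' ll'].
    rewrite addr0 coef_sum (bigD1 k) //= [X in _ + X]big1 => [|k' kk'].
      by rewrite addr0 coefE !eqxx mul1r [in RHS]mxE.
    by rewrite coefE (negbTE kk') !andbF mul0r.
  by rewrite coef_sum big1 // => k' _; rewrite coefE eq_sym (negbTE ll') mul0r.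
rewrite coef_sum big1 // => l' _; rewrite coef_sum big1 // => k' _.
by rewrite coefE (negbTE jj') andbF mul0r.
Qed.

End EntangledPolynomialCode.

(** Supplies the evaluation points of the code and, over a finite field, an indexing of scalars. *)
Lemma card_le_injection (T : Type) (q : nat) :
  (`I_q #<= [set: T])%card -> exists x : 'I_q -> T, injective x.
Proof.
move=> /card_leP[f].
pose u (i : 'I_q) : `I_q := SigSub (@mem_set _ `I_q i (ltn_ord i)).
exists (fun i => set_val (f (u i))) => i j /val_inj /inj eij.
by apply/val_inj; have /(congr1 set_val) := eij (mem_set I) (mem_set I).
Qed.

(** * Counting bound over a finite field *)

Section CutSet.
Variables (F : fieldType) (N : nat).
Hypothesis F_finite : finite_set [set: F].

(** [F] has no [finType] structure; injections both ways with ['I_q] allow counting in finite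
    function types. *)
Lemma finite_field_code : exists2 q : nat, 1 < q &
  (exists c : F -> 'I_q, injective c) /\ (exists c' : 'I_q -> F, injective c').
Proof.
have /finite_setP[q /card_eqPle[/pcard_leP[c] /card_le_injection exc']] :=
  F_finite.
have cq y : c y < q by have := @funS _ _ _ _ c y I.
have c_inj : injective c by move=> y z; apply: (@inj _ _ _ c); rewrite inE.
exists q; last split=> //.
- have : c 0%R != c 1%R by rewrite (inj_eq c_inj) eq_sym oner_eq0.
  by have := cq 0%R; have := cq 1%R; lia.
- by exists (fun y => Ordinal (cq y)) => y z /(congr1 val) /c_inj.
Qed.

(** With q = |F|, the q^(ab) inputs inject into the q^(|K|(a/d)(b/e)) families of encodings, and ab
    = de(a/d)(b/e). *)
Lemma encoding_card (a b d e : nat) (K : {set 'I_N})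
    (E : 'I_N -> 'M[F]_(a, b) -> 'M[F]_(a %/ d, b %/ e)) :
  0 < a -> 0 < b -> d %| a -> e %| b ->
  (forall X Y, (forall i, i \in K -> E i X = E i Y) -> X = Y) ->
  d * e <= #|K|.
Proof.
move=> a0 b0 da eb E_inj.
have [q q1 [[c c_inj] [c' c'_inj]]] := finite_field_code.
pose M (g : {ffun 'I_a * 'I_b -> 'I_q}) : 'M[F]_(a, b) :=
  (\matrix_(x, y) c' (g (x, y)))%R.
pose G (g : {ffun 'I_a * 'I_b -> 'I_q}) :
    {ffun {i | i \in K} * ('I_(a %/ d) * 'I_(b %/ e)) -> 'I_q} :=
  [ffun z => c (E (val z.1) (M g) z.2.1 z.2.2)].
have G_inj : injective G.
  move=> g g' /ffunP eG.
  have /matrixP eM : M g = M g'.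
    apply: E_inj => i iK; apply/matrixP => x y; apply: c_inj.
    by have := eG (exist _ i iK, (x, y)); rewrite !ffunE.
  by apply/ffunP => -[x y]; apply: c'_inj; have := eM x y; rewrite !mxE.
have := leq_card _ G_inj.
rewrite !card_ffun !card_prod !card_ord card_sig leq_exp2l //.
rewrite -{1}(divnK da) -{1}(divnK eb) mulnACA [X in X <= _]mulnC.
by rewrite leq_pmul2r // muln_gt0 !divn_dvd_gt0.
Qed.

Lemma mulmx_trl_inj (r s t : nat) (B B' : 'M[F]_(s, t)) : 0 < r ->
  (forall A : 'M[F]_(s, r), A^T *m B = A^T *m B')%R -> B = B'.
Proof.
move=> r0 eqB; apply/row_matrixP => i; pose z := Ordinal r0.
have := congr1 (row z) (eqB (delta_mx i z)).
by rewrite !row_mul trmx_delta rowE mul_delta_mx -!rowE.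
Qed.

Lemma recoverable_lower_bound (p m n s r t k : nat)
    (S : strategy F N p m n s r t) :
  0 < s -> 0 < r -> 0 < t -> p %| s -> m %| r -> n %| t ->
  recoverable S k -> p * m <= k /\ p * n <= k.
Proof.
move=> s0 r0 t0 ps mr nt [kN rec].
pose K := [set widen_ord kN i | i : 'I_k].
have cK : #|K| = k.
  by rewrite card_imset ?card_ord // => i j /(congr1 val) /= /val_inj.
rewrite -cK; split.
  (* Encodings of [X] and [Y] that agree on [K] give equal worker results, hence X^T B = Y^T B for
     every [B]. *)
  apply: (encoding_card (E := encA S)) => // X Y eXY.
  apply: (mulmx_trl_inj t0) => B; apply: trmx_inj; rewrite !trmx_mul !trmxK.
  rewrite -!(rec K cK) /estimate; congr dec; apply: funext => -[i iK].
  by rewrite /worker_result /= eXY.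
apply: (encoding_card (E := encB S)) => // X Y eXY.
apply: (mulmx_trl_inj r0) => A.
rewrite -!(rec K cK) /estimate; congr dec; apply: funext => -[i iK].
by rewrite /worker_result /= eXY.
Qed.

End CutSet.

(** * Minima of thresholds and assembly of the bounds *)

Lemma exists_minimum (P : nat -> Prop) (k : nat) : P k ->
  exists2 l, is_minimum P l & l <= k.
Proof.
move=> Pk; have exP : exists l, `[< P l >] by exists k; apply/asboolP.
case: (ex_minnP exP) => l /asboolP Pl l_min; exists l; last exact/l_min/asboolP.
by split=> // l' /asboolP /l_min.
Qed.

Theorem theorem2 (p m n N : nat)
    (hp : 0 < p) (hm : 0 < m) (hn : 0 < n) (hN : 0 < N) :
  exists q0 : nat,
    forall F : fieldType, (`I_q0 #<= [set: F])%card ->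
    forall s r t : nat, 0 < s -> 0 < r -> 0 < t ->
    p %| s -> m %| r -> n %| t ->
    m = 1 \/ n = 1 ->
    ((exists2 S : strategy F N p m n s r t, linear_code S & recoverable S N) ->
      K_linear_star F N p m n s r t (K_entangled_poly p m n N)) /\
    (finite_set [set: F] ->
      (exists S : strategy F N p m n s r t, recoverable S N) ->
      exists2 k : nat, K_star F N p m n s r t k
        & ((K_entangled_poly p m n N)%:R / 2 < k%:R :> rat)%R /\
          k <= K_entangled_poly p m n N).
Proof.
(* [q0 = N] provides N distinct evaluation points. *)
exists N => F /card_le_injection[x x_inj] s r t s0 r0 t0 ps mr nt mn1.
(* If N is too small for the code, the claimed threshold is N and the assumed strategy serves. [Q]
   is linearity or the trivial predicate. *)
have entangled (Q : strategy F N p m n s r t -> Prop) :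
    (forall S, linear_code S -> Q S) -> (exists2 S, Q S & recoverable S N) ->
    exists2 S, Q S & recoverable S (K_entangled_poly p m n N).
  move=> QS exN; rewrite /K_entangled_poly; case: ifP => // leN.
  exists (entangled_code p m n s r t x); first exact/QS/entangled_linear.
  exact: entangled_recoverable.
split=> [/entangled[//|S linS recS]|finF [S0 rec0]].
  (* The converse serves twice: against competing linear codes and to identify the threshold of [S]
     itself. *)
  split=> [|l [S' linS' [recS' _]]]; last exact: linear_converse recS'.
  by exists S => //; split=> // l; apply: linear_converse.
have [//||S _ recS] := entangled (fun=> True); first by exists S0.
have [l0 thr0 le0] := exists_minimum recS.
pose C l := exists2 S : strategy F N p m n s r t, True & recovery_threshold S l.
have [k kmin lek] := @exists_minimum C l0 (ex_intro2 _ _ S I thr0).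
exists k; first exact: kmin.
split; last exact: leq_trans le0.
have [[S' _ [recS' _]] _] := kmin.
have [pmk pnk] := recoverable_lower_bound finF s0 r0 t0 ps mr nt recS'.
have pmnk : p * m * n <= k.
  by case: mn1 => e; rewrite e ?muln1 in pmk pnk *.
(* The claim becomes K < 2k, which follows from 2k >= 2pmn >= pmn + p. *)
rewrite ltr_pdivrMr // -natrM ltr_nat.
have : K_entangled_poly p m n N <= p * m * n + p - 1.
  by rewrite /K_entangled_poly; case: ifP => // /negbT; lia.
have : p <= p * m * n by rewrite -mulnA leq_pmulr // muln_gt0 hm.
lia.
Qed.
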